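(* Let $G=(V,E)$ be a finite simple undirected graph with at least one vertex, and let $\mu(G,\mathbf{x}\oplus\mathbf{w})$ be its homogeneous multivariate matching polynomial. Then the hyperbolicity cone of $\mu(G,\mathbf{x}\oplus\mathbf{w})$ with respect to $\mathbf{e}=\mathbf{1}\oplus\mathbf{0}\in\mathbb{R}^{V}\times\mathbb{R}^{E}$ is spectrahedral.
   Context: A homogeneous polynomial $h\in\mathbb{R}[x_1,\dots,x_n]$ is hyperbolic with respect to $\mathbf{e}\in\mathbb{R}^n$ if $h(\mathbf{e})\neq 0$ and for every $\mathbf{x}\in\mathbb{R}^n$ the univariate polynomial $t\mapsto h(t\mathbf{e}-\mathbf{x})$ has only real zeros. Its hyperbolicity cone with respect to $\mathbf{e}$ is $\Lambda_+(h,\mathbf{e})=\{\mathbf{x}\in\mathbb{R}^n : \text{all zeros of } t\mapsto h(t\mathbf{e}-\mathbf{x}) \text{ are} \geq 0\}$. A convex cone in $\mathbb{R}^n$ is spectrahedral if it is of the form $\{\mathbf{x}\in\mathbb{R}^n:\sum_{i=1}^n x_iA_i \text{ is positive semidefinite}\}$, where $A_1,\dots,A_n$ are real symmetric matrices of the same size such that $\sum_{i=1}^n y_iA_i$ is positive definite for some $(y_1,\dots,y_n)\in\mathbb{R}^n$. For a finite simple graph $G=(V,E)$, a matching is a set of edges no two of which share a vertex; $\mathcal{M}(G)$ is the set of all matchings (including $\emptyset$) and $V(M)$ is the set of vertices covered by $M$. With indeterminates $\mathbf{x}=(x_v)_{v\in V}$ and $\mathbf{w}=(w_e)_{e\in E}$,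 the homogeneous multivariate matching polynomial is $$\mu(G,\mathbf{x}\oplus\mathbf{w})=\sum_{M\in\mathcal{M}(G)}(-1)^{|M|}\prod_{v\notin V(M)}x_v\prod_{e\in M}w_e^2,$$ a homogeneous polynomial of degree $|V|$ on $\mathbb{R}^V\times\mathbb{R}^E$. It is hyperbolic with respect to $\mathbf{1}\oplus\mathbf{0}$, the point with all $x_v=1$ and all $w_e=0$. *)

(* Defs.v *)
From HB Require Import structures.
From mathcomp Require Import all_boot all_order all_algebra.
From mathcomp Require Import reals complex.
From mathcomp Require Import mpoly.

Set Implicit Arguments.
Unset Strict Implicit.
Unset Printing Implicit Defensive.

Import Order.TTheory GRing.Theory Num.Theory.
Local Open Scope ring_scope.

Section Hyperbolicity.
Variables (R : realType) (n : nat).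
Implicit Types (h : {mpoly R[n]}) (e x : 'rV[R]_n).

(* The univariate polynomial t |-> h (t e - x). *)
Definition line_poly h e x : {poly R} :=
  mmap polyC (fun i => e 0 i *: 'X - (x 0 i)%:P) h.

(* The zeros are the complex ones: in R[i], 0 <= z means that z is real and
   nonnegative. When h is hyperbolic with respect to e, all the zeros are real
   and only their sign matters. *)
Definition hyperbolicity_cone h e x : Prop :=
  forall z : R[i], root (map_poly (real_complex R) (line_poly h e x)) z ->
    0 <= z.

End Hyperbolicity.

Section Spectrahedral.
Variable R : realType.

Definition psdmx m (A : 'M[R]_m) : Prop :=
  A^T = A /\ forall v : 'cV[R]_m, 0 <= (v^T *m A *m v) 0 0.

Definition pdmx m (A : 'M[R]_m) : Prop :=
  A^T = A /\ forall v : 'cV[R]_m, v != 0 -> 0 < (v^T *m A *m v) 0 0.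

(* Matrices have positive size: with m = 0, every matrix would be positive
   definite and the whole space would count as spectrahedral. *)
Definition spectrahedral n (K : 'rV[R]_n -> Prop) : Prop :=
  exists (m : nat) (A : 'I_n -> 'M[R]_m),
    [/\ (0 < m)%N,
        forall i, (A i)^T = A i,
        exists y : 'rV[R]_n, pdmx (\sum_i y 0 i *: A i)
      & forall x : 'rV[R]_n, K x <-> psdmx (\sum_i x 0 i *: A i)].

End Spectrahedral.

Section MatchingPolynomial.
Variables (R : realType) (V : finType) (E : {set {set V}}).

Definition edge : finType := {e : {set V} | e \in E}.

Definition matching (M : {set edge}) : bool :=
  [forall e in M, forall f in M, (e != f) ==> [disjoint val e & val f]].

Definition covered (M : {set edge}) : {set V} := \bigcup_(e in M) val e.

(* The coordinates of R^V x R^E are indexed by V + E through enum_rank. *)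
Definition nvars : nat := #|{: V + edge}|.

Definition vertex_var (v : V) : {mpoly R[nvars]} :=
  'X_(enum_rank (inl v : V + edge)).

Definition edge_var (e : edge) : {mpoly R[nvars]} :=
  'X_(enum_rank (inr e : V + edge)).

Definition matching_poly : {mpoly R[nvars]} :=
  \sum_(M : {set edge} | matching M)
    (-1) ^+ #|M| * (\prod_(v | v \notin covered M) vertex_var v)
                 * (\prod_(e in M) edge_var e ^+ 2).

(* The point 1 (+) 0. *)
Definition ones_zeros : 'rV[R]_nvars :=
  \row_i (if enum_val i is inl _ then 1 else 0).

End MatchingPolynomial.

(* Main.v *)
(** Write mu S for the matching polynomial of the subgraph induced by S, so that
mu (u + S) = x_u mu S - sum_v w_uv^2 mu (S - v). A point x lies in the
hyperbolicity cone iff x + s e makes mu V nonzero for all s > 0, since mu V is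
real-rooted along e (Heilmann and Lieb). By interlacing this forces
mu S (x + s e) > 0 for all S and all s > 0.

On the other hand, consider the tree of self-avoiding walks from u in S + u
(Godsil's path tree), with the coordinate of the endpoint of a walk as diagonal
entry and the coordinate of the last edge as off-diagonal entry. Completing
squares from the leaves, the minimum of its quadratic form over the functions
equal to 1 at the root is mu (S + u) / mu S, as both satisfy the same recurrence.
Hence the direct sum of these trees over all S and u is positive semidefinite
exactly on the hyperbolicity cone, and at e it is the identity matrix. *)

Require Import Defs.
From mathcomp Require Import all_boot all_order all_algebra.
From mathcomp Require Import reals complex polyrcf mpoly.
From mathcomp Require Import ring.

Set Implicit Arguments.
Unset Strict Implicit.
Unset Printing Implicit Defensive.

Import Order.TTheory GRing.Theory Num.Theory.

(** * Matching sums of induced subgraphs and their vertex recurrence *)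

Section InducedMatchingSum.
Local Open Scope ring_scope.
Variables (V : finType) (E : {set {set V}}).

(** The ring is arbitrary because the same sum is evaluated over the reals, the complex numbers,
    univariate polynomials and [{mpoly R[nvars]}]. The subgraph induced by [S] is encoded by a
    condition on [covered M], so that the type of edges does not depend on [S]. *)
Definition mu (T : comNzRingType) (S : {set V}) (a : V -> T)
    (b : edge E -> T) : T :=
  \sum_(M : {set edge E} | matching M && (covered M \subset S))
    (-1) ^+ #|M| * (\prod_(v in S :\: covered M) a v)
                 * (\prod_(e in M) b e ^+ 2).

Lemma matchingP (M : {set edge E}) :
  reflect {in M &, forall e f : edge E, e != f -> [disjoint val e & val f]}
    (matching M).
Proof.
apply: (iffP 'forall_in_forall_inP) => h e f eM fM; first exact/implyP/h.
by apply/implyP; exact: h.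
Qed.

Lemma rmorph_mu (T U : comNzRingType) (phi : {rmorphism T -> U}) S a b :
  phi (mu S a b) = mu S (phi \o a) (phi \o b).
Proof.
rewrite rmorph_sum; apply: eq_bigr => M _.
rewrite !rmorphM rmorphXn rmorphN1 !rmorph_prod.
by under [X in _ * X = _]eq_bigr do rewrite rmorphXn.
Qed.

(** Edge weights enter only through their squares, so their signs may be changed freely. *)
Lemma eq_mu (T : comNzRingType) S (a a' : V -> T) (b b' : edge E -> T) :
  a =1 a' -> (forall e, b e ^+ 2 = b' e ^+ 2) -> mu S a b = mu S a' b'.
Proof.
move=> ha hb; apply: eq_bigr => M _.
congr (_ * _ * _); first by apply: eq_bigr.
by apply: eq_bigr.
Qed.

Lemma covered0 : covered (set0 : {set edge E}) = set0.
Proof. by rewrite /covered big_set0. Qed.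

Lemma covered_setU1 (e : edge E) M : covered (e |: M) = val e :|: covered M.
Proof. by rewrite /covered bigcup_setU big_set1. Qed.

Lemma edge_sub_covered (e : edge E) (M : {set edge E}) :
  e \in M -> val e \subset covered M.
Proof. by move=> eM; rewrite /covered (bigcup_max e). Qed.

Lemma matching_setU1 (e : edge E) (M : {set edge E}) :
  e \notin M -> matching (e |: M) = matching M && [disjoint val e & covered M].
Proof.
move=> eM; apply/matchingP/andP => [h|[/matchingP h d] f g].
  split; first by apply/matchingP=> f g fM gM; apply: h; rewrite inE ?fM ?gM orbT.
  apply/bigcup_disjointP => f fM.
  apply: h; rewrite ?setU11 //; first by rewrite inE fM orbT.
  by apply: contraNneq eM => ->.
have d' k : k \in M -> [disjoint val e & val k].
  by move=> kM; apply: disjointWr d; exact: edge_sub_covered.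
rewrite !inE => /orP[/eqP->|fM] /orP[/eqP->|gM]; rewrite ?eqxx //.
- by move=> _; exact: d'.
- by move=> _; rewrite disjoint_sym; exact: d'.
- exact: h.
Qed.

Lemma mu0 (T : comNzRingType) (a : V -> T) (b : edge E -> T) :
  (forall e, e \in E -> e != set0) -> mu set0 a b = 1.
Proof.
move=> E0; rewrite /mu (big_pred1 set0) => [|M /=].
  by rewrite cards0 set0D !big_set0 !mulr1.
apply/andP/eqP => [[_]|->]; last first.
  by split; [apply/matchingP => e; rewrite inE|rewrite covered0].
rewrite subset0 => /eqP h; apply/setP => e; rewrite inE; apply/negP => eM.
have := edge_sub_covered eM; rewrite h subset0.
by apply/negP/E0; exact: valP.
Qed.

(** Matchings that avoid [u] give the first term. Any other matching has exactly one edge [e]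
    through [u], and removing it leaves a matching inside [S :\: val e]. *)
Lemma mu_setU1_edge (T : comNzRingType) (a : V -> T) (b : edge E -> T) u (S : {set V}) :
  u \notin S ->
  mu (u |: S) a b = a u * mu S a b
    - \sum_(e : edge E | (u \in val e) && (val e \subset u |: S))
        b e ^+ 2 * mu (S :\: val e) a b.
Proof.
move=> uS; rewrite {1}/mu (bigID (fun M : {set edge E} => u \in covered M)) /= addrC.
congr (_ + _).
  rewrite /mu big_distrr /=; apply: eq_big => [M|M /andP[/andP[_ _] uM]].
    rewrite -andbA; congr (_ && _); apply/andP/idP => [[h uM]|h].
      apply/subsetP => v vM; have := subsetP h v vM; rewrite !inE.
      by case/orP=> [/eqP vu|//]; rewrite -vu vM in uM.
    by rewrite (subset_trans h (subsetUr _ _)) (contra (subsetP h u)).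
  have -> : (u |: S) :\: covered M = u |: (S :\: covered M).
    by apply/setP=> v; rewrite !inE; case: eqP => [->|]; rewrite /= ?uM.
  by rewrite big_setU1 /= ?inE ?(negPf uS) ?andbF // mulrCA !mulrA.
rewrite -sumrN.
pose F (M : {set edge E}) := (-1) ^+ #|M| * (\prod_(v in (u |: S) :\: covered M) a v)
                 * (\prod_(e in M) b e ^+ 2).
(* Writing a term as a sum over the single edge of [M] through [u] allows the order of summation to
   be exchanged. *)
have F1 (M : {set edge E}) : (matching M && (covered M \subset u |: S)) && (u \in covered M) ->
    F M = \sum_(e in M | u \in val e) F M.
  case/andP=> /andP[/matchingP mM _] /bigcupP[e eM ue].
  rewrite (big_pred1 e) // => f /=; apply/andP/eqP => [[fM uf]|->]; last by [].
  apply/eqP; apply/negPn/negP => fe; have := mM _ _ fM eM fe.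
  by move/disjointFr => /(_ _ uf); rewrite ue.
rewrite (eq_bigr _ F1) /=.
rewrite (exchange_big_dep
   (fun e : edge E => (u \in val e) && (val e \subset u |: S))) /=; last first.
  move=> M e /andP[/andP[_ sM] _] /andP[eM ->] /=.
  exact: subset_trans (edge_sub_covered eM) sM.
apply: eq_bigr => e /andP[ue se].
rewrite /mu big_distrr /= -sumrN.
rewrite (reindex_onto (fun M => e |: M) (fun M => M :\ e)) /=; last first.
  by move=> M /andP[_ /andP[eM _]]; rewrite setD1K.
have cE (M : {set edge E}) : e \notin M ->
    (matching (e |: M) && (covered (e |: M) \subset u |: S)) =
    (matching M && (covered M \subset S :\: val e)).
  move=> eM; rewrite matching_setU1 // covered_setU1 subUset se /= -andbA.
  congr (_ && _); apply/andP/subsetP => [[d s] v vM|h].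
    rewrite !inE (disjointFl d vM) /=; move: (subsetP s v vM); rewrite !inE.
    by case/orP=> // /eqP vu; move: (disjointFl d vM); rewrite vu ue.
  split.
    rewrite disjoint_sym disjoint_subset; apply/subsetP=> v vM.
    by move: (h v vM); rewrite !inE => /andP[].
  apply/subsetP=> v vM.
  by move: (h v vM); rewrite !inE => /andP[_ ->]; rewrite orbT.
have eN (M : {set edge E}) : covered M \subset S :\: val e -> e \notin M.
  move=> s; apply/negP=> eM; have := subsetP s u (subsetP (edge_sub_covered eM) u ue).
  by rewrite !inE ue.
apply: eq_big => [M|M].
  rewrite setU11 ue andbT covered_setU1 inE ue /= andbT.
  rewrite -covered_setU1.
  have [eM|eM] := boolP (e \in M).
    have /negPf-> : (e |: M) :\ e != M.
      by apply: contraTneq eM => <-; rewrite !inE eqxx.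
    by rewrite andbF; apply/esym/negP => /andP[_ /eN]; rewrite eM.
  by rewrite setU1K // eqxx !andbT; exact: cE.
case/andP => _ /eqP hM; have eM : e \notin M by rewrite -hM !inE eqxx.
rewrite /F cardsU1 eM big_setU1 //= covered_setU1.
have -> : (u |: S) :\: (val e :|: covered M) = (S :\: val e) :\: covered M.
  apply/setP=> v; rewrite !inE negb_or; case: (eqVneq v u) => [->|_] /=.
    by rewrite ue /= andbF.
  by rewrite andbA; congr (_ && _); rewrite andbC.
have move_sign (s A c B : T) : -1 * s * A * (c * B) = - (c * (s * A * B)) by ring.
rewrite [(-1) ^+ _]exprS; exact: move_sign.
Qed.

Hypothesis E_edges : forall e : {set V}, e \in E -> #|e| = 2%N.

(** The value [None] marks a pair that is not an edge; read through [oapp b 0], it gets weight 0, so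
    sums may range over all vertices. *)
Definition edge_of (u v : V) : option (edge E) := insub [set u; v].

Lemma mu_setU1 (T : comNzRingType) (a : V -> T) (b : edge E -> T) u (S : {set V}) :
  u \notin S ->
  mu (u |: S) a b = a u * mu S a b
    - \sum_(v in S) oapp b 0 (edge_of u v) ^+ 2 * mu (S :\ v) a b.
Proof.
move=> uS; rewrite mu_setU1_edge //; congr (_ - _).
rewrite [RHS](bigID (fun v => [set u; v] \in E)) /= [X in _ + X]big1 ?addr0; last first.
  by move=> v /andP[_ h]; rewrite /edge_of insubN // expr0n mul0r.
have [->|[v0 v0S]] := set_0Vmem S.
  rewrite !big1 //.
    by move=> v; rewrite inE.
  move=> e /andP[_]; rewrite setU0 => /subset_leq_card.
  by rewrite cards1 (E_edges (valP e)).
(* The other endpoint of an edge through [u]. *)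
pose g (e : edge E) : V := odflt u [pick v | v \in val e :\ u].
have gE (e : edge E) : u \in val e -> val e = [set u; g e] /\ g e != u.
  move=> ue; have := E_edges (valP e); rewrite (cardsD1 u) ue add1n => -[].
  move/eqP/cards1P=> [v hv]; have : g e \in val e :\ u.
    by rewrite /g; case: pickP => //= /(_ v); rewrite hv set11.
  have {2}<- := setD1K ue; rewrite hv inE => /eqP->; split=> //.
  by have := set11 v; rewrite -hv !inE => /andP[].
(* The edge [e0] serves as the default value that makes the map from neighbours to edges total;
   without such an edge both sums are empty. *)
have [e0|noe] := pickP (fun e : edge E => (u \in val e) && (val e \subset u |: S));
  last first.
  rewrite [LHS]big_pred0 // [RHS]big_pred0 // => v.
  apply/negP => /andP[vS vE]; have := noe (exist _ [set u; v] vE).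
  by rewrite /= !inE eqxx /= subUset !sub1set !inE eqxx vS orbT.
move=> _; rewrite (reindex_onto (fun v => odflt e0 (edge_of u v)) g) /=; last first.
  move=> e /andP[ue se]; have [h1 h2] := gE e ue.
  by rewrite /edge_of -h1 valK.
apply: eq_big => [v|v].
  rewrite /edge_of; case: insubP => [e eE ve|nE] /=; last first.
    rewrite (negPf nE) andbF; apply/negP => /andP[/andP[ue se]/eqP gv].
    by have [h _] := gE _ ue; move: nE; rewrite -gv -h (valP e0).
  rewrite eE andbT ve !inE eqxx /= subUset !sub1set !inE eqxx /=.
  have ue : u \in val e by rewrite ve !inE eqxx.
  have [h1 h2] := gE e ue.
  case: (eqVneq v u) => [vu|vu] /=.
    by rewrite vu (negPf h2) (negPf uS).
  have -> : g e = v.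
    have : g e \in [set u; v] by rewrite -ve h1 !inE eqxx orbT.
    by rewrite !inE (negPf h2) => /eqP.
  by rewrite eqxx andbT.
case/andP=> /andP[ue se] /eqP gv; rewrite /edge_of.
case: insubP => [e eE ve|nE] /=; last first.
  exfalso; move: ue se gv; rewrite /edge_of insubN //= => ue _ gv.
  by have [h _] := gE _ ue; move: nE; rewrite -gv -h (valP e0).
congr (_ * mu _ _ _); apply/setP=> w; rewrite ve !inE negb_or.
by case: (eqVneq w u) => [->|] //=; rewrite (negPf uS) andbF.
Qed.

Lemma mu_set0 (T : comNzRingType) (a : V -> T) (b : edge E -> T) :
  mu set0 a b = 1.
Proof.
by apply: mu0 => e /E_edges h; rewrite -card_gt0 h.
Qed.

Lemma proper_set_ind (P : {set V} -> Prop) :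
  (forall S : {set V}, (forall S' : {set V}, S' \proper S -> P S') -> P S) ->
  forall S, P S.
Proof.
move=> PS S; have [k] := ubnP #|S|; elim: k S => // k IH S.
rewrite ltnS => Sk; apply: PS => S' /proper_card S'S; apply: IH.
exact: leq_trans Sk.
Qed.

(** An edge covers two vertices, so the number of vertex factors of every term has the parity of
    [#|S|]. In the recurrence this appears as the removal of both [u] and [v]. *)
Lemma muN (T : comNzRingType) (a : V -> T) (b : edge E -> T) (S : {set V}) :
  mu S (fun v => - a v) b = (-1) ^+ #|S| * mu S a b.
Proof.
elim/proper_set_ind: S => S; have [->|[u uS]] := set_0Vmem S.
  by rewrite !mu_set0 cards0 mulr1.
rewrite -(setD1K uS); move: (S :\ u) (setD11 u S) => {uS}S /negbT uS IH.
have SuS : S \proper u |: S by rewrite properE subsetUr subUset sub1set negb_and uS.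
rewrite !mu_setU1 // (IH S SuS) cardsU1 uS mulrBr; congr (_ - _).
  by rewrite exprS mulN1r !mulNr mulrCA.
rewrite big_distrr; apply: eq_bigr => v vS /=.
rewrite IH; last by apply: sub_proper_trans SuS; exact: subsetDl.
rewrite (cardsD1 v S) vS.
by rewrite addnA exprD [(-1) ^+ (true + true)%N]sqrrN expr1n mul1r mulrCA.
Qed.

End InducedMatchingSum.

(** * Real-rootedness through the upper half plane *)

Section RealRootedness.
Local Open Scope ring_scope.
Local Open Scope complex_scope.
Variables (R : rcfType) (V : finType) (E : {set {set V}}).
Hypothesis E_edges : forall e : {set V}, e \in E -> #|e| = 2%N.

Lemma ImV_lt0 (z : R[i]) : 0 < complex.Im z -> complex.Im z^-1 < 0.
Proof.
case: z => a b /= b0; rewrite oppr_lt0 divr_gt0 //.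
by apply: ltr_wpDl; rewrite ?sqr_ge0 ?exprn_gt0.
Qed.

Lemma Im_scale (c : R) (z : R[i]) : complex.Im (c%:C * z) = c * complex.Im z.
Proof. by case: z => a b /=; rewrite mul0r addr0. Qed.

Lemma Im_sub (y z : R[i]) : complex.Im (y - z) = complex.Im y - complex.Im z.
Proof. by case: y z => [a b] [c d]. Qed.

Lemma Im_sum (I : finType) (P : pred I) (F : I -> R[i]) :
  complex.Im (\sum_(i | P i) F i) = \sum_(i | P i) complex.Im (F i).
Proof. by apply: big_morph => [[a b] [c d]|]. Qed.

(* Heilmann and Lieb: z |-> -1/z preserves the open upper half plane, so the
   recurrence propagates positivity of the imaginary part of the ratios. *)
Lemma mu_upper_half_plane (a : V -> R[i]) (w : edge E -> R) (S : {set V}) :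
  (forall v, 0 < complex.Im (a v)) ->
  mu S a (fun e => (w e)%:C) != 0 /\
  (forall u, u \notin S -> 0 < complex.Im (mu (u |: S) a (fun e => (w e)%:C) /
                                   mu S a (fun e => (w e)%:C))).
Proof.
move=> a_gt0; set b := fun e => _.
elim/proper_set_ind: S => S IH.
have Sv v : v \in S -> S :\ v \proper S by move=> vS; rewrite properD1.
have muS : mu S a b != 0.
  have [->|[u uS]] := set_0Vmem S; first by rewrite mu_set0 // oner_neq0.
  have [_ /(_ u)] := IH _ (Sv u uS); rewrite setD11 setD1K // => /(_ isT).
  by apply: contraTneq => ->; rewrite mul0r ltxx.
split=> // u uS; rewrite mu_setU1 // mulrBl mulfK // Im_sub.
rewrite ltr_wpDr // oppr_ge0 mulr_suml Im_sum; apply: sumr_le0 => v vS.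
have [mSv /(_ v)] := IH _ (Sv v vS); rewrite setD11 setD1K // => /(_ isT).
move/ImV_lt0; rewrite invf_div => h.
have -> : oapp b 0 (edge_of E u v) = (oapp w 0 (edge_of E u v))%:C.
  by case: edge_of.
rewrite -rmorphXn -mulrA Im_scale.
by rewrite mulr_ge0_le0 ?sqr_ge0 // ltW.
Qed.

(** A zero in the upper half plane is excluded by [mu_upper_half_plane]; one in the lower half plane
    is conjugated into the upper one, the data being real. *)
Lemma mu_real_rooted (x : V -> R) (w : edge E -> R) (z : R[i]) :
  mu setT (fun v => z - (x v)%:C) (fun e => (w e)%:C) = 0 -> complex.Im z = 0.
Proof.
have key z' : 0 < complex.Im z' ->
    mu setT (fun v => z' - (x v)%:C) (fun e => (w e)%:C) != 0.
  move=> z0; apply: (proj1 (@mu_upper_half_plane _ w _ _)) => v.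
  by case: z' z0 => c d /=; rewrite oppr0 addr0.
case: (ltgtP (complex.Im z) 0) => // h m0.
  have hc : 0 < complex.Im (conjc z) by case: z h {m0} => c d /=; rewrite oppr_gt0.
  have /eqP := key _ hc; case; rewrite -[RHS](rmorph0 (@conjc R)) -m0 rmorph_mu.
  by apply: eq_mu => [v|e] /=; rewrite ?oppr0 // rmorphB /= oppr0.
by have := key _ h; rewrite m0 eqxx.
Qed.

End RealRootedness.

(** * Positivity passes from the whole graph to its induced subgraphs *)

Section Positivity.
Local Open Scope ring_scope.
Variable R : rcfType.

Lemma horner_gt0_ray (p : {poly R}) r :
  0 < lead_coef p -> (forall s, r < s -> p.[s] != 0) ->
  forall s, r < s -> 0 < p.[s].
Proof.
move=> lp pN0 s rs; rewrite lt_neqAle eq_sym pN0 // leNgt; apply/negP=> ps.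
have [n hn] := poly_pinfty_gt_lc lp.
have ht := hn (Num.max n s); rewrite le_max lexx /= in ht.
have sg : p.[s] * p.[Num.max n s] <= 0.
  by rewrite nmulr_rle0 // (le_trans _ (ht isT)) // ltW.
have sm : s <= Num.max n s by rewrite le_max lexx orbT.
have [y] := polyrcf.poly_ivt sm sg.
rewrite in_itv /= => /andP[sy _]; apply/negP/pN0.
exact: lt_le_trans sy.
Qed.

Lemma horner_ge0_ray (p : {poly R}) r :
  (forall s, r < s -> 0 < p.[s]) -> 0 <= p.[r].
Proof.
move=> p0; rewrite leNgt; apply/negP => pr.
have r1 : r < r + 1 by rewrite ltrDl.
have sg : p.[r] * p.[r + 1] < 0 by rewrite nmulr_rlt0 // p0.
have [y] := polyrcf.poly_ivtoo (ltW r1) sg.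
rewrite in_itv /= => /andP[ry _] /rootP y0.
by have := p0 _ ry; rewrite y0 ltxx.
Qed.

Lemma largest_root (p : {poly R}) s :
  0 < lead_coef p -> p.[s] <= 0 ->
  exists r, [/\ s <= r, p.[r] = 0 & forall t, r < t -> 0 < p.[t]].
Proof.
move=> lp ps; have [n hn] := poly_pinfty_gt_lc lp.
have pn x : n <= x -> 0 < p.[x] by move/hn; exact: lt_le_trans.
pose m := Num.max n s.
have nm : n <= m by rewrite le_max lexx.
have sm : s <= m by rewrite le_max lexx orbT.
have sg : p.[s] * p.[m] <= 0 by rewrite mulr_le0_ge0 // ltW // pn.
have [y] := polyrcf.poly_ivt sm sg.
rewrite in_itv /= => /andP[sy ym] ry.
have {}ym : y < m.
  by rewrite lt_neqAle ym andbT; apply: contraTneq ry => ->; rewrite rootE gt_eqF // pn.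
(* The interval starts at [s - 1] because it is open and the root may be [s] itself. *)
have yI : y \in `]s - 1, m[ by rewrite in_itv /= ym andbT (lt_le_trans _ sy) // ltrBlDr ltrDl.
case: (prev_rootP p (s - 1) m) => [p0|r pN0 pr rI hr|c pN0 _ hr].
- by move: lp; rewrite p0 lead_coef0 ltxx.
- exists r; split=> //.
    apply: le_trans sy _; rewrite leNgt; apply/negP => ry'.
    by have := hr y; rewrite in_itv /= ry' ym ry => /(_ isT).
  apply: horner_gt0_ray lp _ => t rt; have [tm|mt] := ltP t m.
    by have := hr t; rewrite in_itv /= rt tm => /(_ isT).
  by rewrite gt_eqF // pn // (le_trans nm).
- by have := hr y yI; rewrite ry.
Qed.

Variables (V : finType) (E : {set {set V}}).
Hypothesis E_edges : forall e : {set V}, e \in E -> #|e| = 2%N.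
Variables (x : V -> R) (w : edge E -> R).

Definition mu_shift (S : {set V}) (s : R) : R := mu S (fun v => x v + s) w.

Definition mu_poly (S : {set V}) : {poly R} :=
  mu S (fun v => 'X + (x v)%:P) (fun e => (w e)%:P).

Lemma horner_mu_poly S s : (mu_poly S).[s] = mu_shift S s.
Proof.
rewrite -[LHS]/(horner_eval s _) rmorph_mu; apply: eq_mu => [v|e] /=.
  by rewrite /horner_eval !hornerE addrC.
by rewrite /horner_eval hornerC.
Qed.

(** In the recurrence the edge terms have smaller degree than the product, which is why the size is
    carried through the induction. Monicity fixes the sign at infinity. *)
Lemma mu_poly_monic S : (size (mu_poly S) = #|S|.+1) /\ mu_poly S \is monic.
Proof.
elim/proper_set_ind: S => S; have [->|[u uS]] := set_0Vmem S.
  by rewrite /mu_poly mu_set0 // size_poly1 cards0 monic1.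
rewrite -(setD1K uS); move: (S :\ u) (setD11 u S) => {uS}S /negbT uS IH.
have SuS : S \proper u |: S by rewrite properE subsetUr subUset sub1set negb_and uS.
have [szS mS] := IH S SuS.
rewrite /mu_poly mu_setU1 // -!/(mu_poly _) cardsU1 uS.
set q := \sum_(v in S) _.
have szq : (size q <= #|S|)%N.
  apply: leq_trans (size_sum _ _ _) _; apply/bigmax_leqP => v vS.
  have -> : oapp (fun e => (w e)%:P) 0 (edge_of E u v)
          = (oapp w 0 (edge_of E u v))%:P by case: edge_of.
  rewrite -rmorphXn mul_polyC; apply: leq_trans (size_scale_leq _ _) _.
  have [-> _] := IH (S :\ v) (sub_proper_trans (subsetDl _ _) SuS).
  by rewrite (cardsD1 v S) vS.
have lX : ('X + (x u)%:P : {poly R}) \is monic by exact: monicXaddC.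
have szX : size (('X + (x u)%:P) * mu_poly S) = #|S|.+2.
  by rewrite size_monicM ?monic_neq0 // size_XaddC szS.
have lt : (size (- q) < size (('X + (x u)%:P) * mu_poly S)%R)%N.
  by rewrite szX size_polyN ltnS (leq_trans szq).
split; first by rewrite size_polyDl // szX.
by rewrite monicE lead_coefDl // -monicE monicMl.
Qed.

Lemma mu_poly_lead_gt0 S : 0 < lead_coef (mu_poly S).
Proof. by have [_ /monicP ->] := mu_poly_monic S. Qed.

(* At the largest zero r of mu_shift (S :\ u), the recurrence expresses
   mu_shift S r as a sum of nonpositive terms, because by induction the
   mu_shift (S :\ u :\ v) are nonnegative at r. *)
Lemma mu_shift_gt0_setD1 (S : {set V}) u s0 :
  u \in S -> (forall s, s0 <= s -> 0 < mu_shift S s) ->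
  forall s, s0 <= s -> 0 < mu_shift (S :\ u) s.
Proof.
elim/proper_set_ind: S u s0 => S IH u s0 uS S0 s s0s.
rewrite ltNge -horner_mu_poly; apply/negP => /(largest_root (mu_poly_lead_gt0 _)).
case=> r [sr hr r0]; have := S0 r (le_trans s0s sr).
rewrite -(setD1K uS) /mu_shift mu_setU1 ?setD11 // -!/(mu_shift _ _).
rewrite -[mu_shift (S :\ u) r]horner_mu_poly hr mulr0 add0r oppr_gt0 ltNge => /negP.
apply; apply: sumr_ge0 => v vS; apply: mulr_ge0; first exact: sqr_ge0.
(* Nonnegativity at [r] follows by continuity from positivity at every [t > r], where the induction
   hypothesis applies to [S :\ u] on the ray from [t]. *)
rewrite -/(mu_shift _ _) -horner_mu_poly; apply: horner_ge0_ray => t rt; rewrite horner_mu_poly.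
apply: (IH (S :\ u) _ v t) => //; first by rewrite properD1.
by move=> t' tt'; rewrite -horner_mu_poly r0 // (lt_le_trans rt).
Qed.

(** On the full vertex set, absence of zeros and a positive leading coefficient give positivity;
    vertices are then removed one at a time, by induction on the size of the complement. *)
Lemma mu_shift_gt0 :
  (forall s, 0 < s -> mu_shift setT s != 0) ->
  forall S s, 0 < s -> 0 < mu_shift S s.
Proof.
move=> hT S s s0.
have [k] := ubnP #|~: S|; elim: k S s s0 => // k IH S s s0 Sk.
have [S0|[u uS]] := set_0Vmem (~: S).
  rewrite -[S]setCK S0 setC0 -horner_mu_poly.
  apply: (horner_gt0_ray (mu_poly_lead_gt0 _) _ s0) => t t0.
  by rewrite horner_mu_poly hT.
rewrite inE in uS; rewrite -(setU1K uS).
apply: (@mu_shift_gt0_setD1 _ _ s) => [|t st|]; rewrite ?setU11 ?lexx //.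
apply: IH; first exact: lt_le_trans st.
rewrite ltnS in Sk; apply: leq_trans Sk; rewrite (cardsD1 u (~: S)) inE uS.
rewrite ltnS; apply/subset_leq_card/subsetP => v; rewrite !inE negb_or.
by case/andP=> -> ->.
Qed.

End Positivity.

(** * Quadratic forms of coordinate patterns and their direct sums *)

Section PatternForm.
Local Open Scope ring_scope.
Variables (R : comNzRingType) (K : Type).

(* A linear matrix pencil all of whose nonzero entries are coordinates: None
   stands for a zero entry and Some c for the coordinate x c. *)
Definition pattern (I : Type) := I -> I -> option K.

Definition pform (I : finType) (t : pattern I) (x : K -> R) (f : I -> R) : R :=
  \sum_i \sum_j oapp x 0 (t i j) * f i * f j.

Definition dsum (L : eqType) I (t : L -> pattern I) : pattern (L * I) :=
  fun p q => if p.1 == q.1 then t p.1 p.2 q.2 else None.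

Lemma sum_pair (L I : finType) (F : L * I -> R) :
  \sum_p F p = \sum_l \sum_i F (l, i).
Proof. by rewrite pair_bigA; apply: eq_bigr => -[]. Qed.

Lemma pform_dsum (L I : finType) (t : L -> pattern I) x f :
  pform (dsum t) x f = \sum_l pform (t l) x (fun i => f (l, i)).
Proof.
rewrite /pform sum_pair; apply: eq_bigr => l _; apply: eq_bigr => i _.
rewrite sum_pair.
rewrite (bigD1 l) //= [X in _ + X]big1 ?addr0 => [|l' l'l].
  by rewrite /dsum /= eqxx.
by rewrite big1 // => j _; rewrite /dsum /= eq_sym (negPf l'l) /= !mul0r.
Qed.

Lemma eq_pform (I : finType) (t : pattern I) x f g :
  f =1 g -> pform t x f = pform t x g.
Proof.
by move=> fg; apply: eq_bigr => i _; apply: eq_bigr => j _; rewrite !fg.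
Qed.

Lemma pformZ (I : finType) (t : pattern I) x c f :
  pform t x (fun i => c * f i) = c ^+ 2 * pform t x f.
Proof.
rewrite mulr_sumr; apply: eq_bigr => i _; rewrite mulr_sumr.
by apply: eq_bigr => j _; ring.
Qed.

Lemma big_option (I : finType) (F : option I -> R) :
  \sum_i F i = F None + \sum_i F (Some i).
Proof.
rewrite (bigD1 None) //=; congr (_ + _).
rewrite (reindex_omap Some id) => [|[i|]] //=.
by apply: eq_bigl => i; rewrite eqxx.
Qed.

End PatternForm.

(** * The path tree and the minimum of its quadratic form *)

Section PathTree.
Local Open Scope ring_scope.
Variables (V : finType) (E : {set {set V}}).
Hypothesis E_edges : forall e : {set V}, e \in E -> #|e| = 2%N.

Let coord : eqType := (V + edge E)%type.

(* Nodes of the tree in which every node of depth less than k has one child for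
   each vertex. *)
Fixpoint tree_node (k : nat) : finType :=
  if k is k'.+1 then option (V * tree_node k')%type : finType
  else unit : finType.

Definition tree_root k : tree_node k := if k is k'.+1 then None else tt.

(* The weighted adjacency matrix of the tree of self-avoiding walks which start
   at u and then stay in S. The children that do not continue such a walk are
   kept, but disconnected from their parent; this makes the set of nodes
   independent of S and u. *)
Fixpoint tree_pattern k (S : {set V}) (u : V) : pattern coord (tree_node k) :=
  match k return pattern coord (tree_node k) with
  | 0 => fun _ _ => Some (inl u)
  | k'.+1 =>
    let link (v : V) (i : tree_node k') : option coord :=
      if (v \in S) && (i == tree_root k')
      then omap inr (edge_of E u v) else None in
    fun p q : option (V * tree_node k') => match p, q return option coord with
      | None, None => Some (inl u)
      | None, Some (v, i) | Some (v, i), None => link v i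
      | Some p, Some q => dsum (fun v => @tree_pattern k' (S :\ v) v) p q
      end
  end.

Lemma tree_pattern_sym k S u p q :
  tree_pattern S u p q = @tree_pattern k S u q p.
Proof.
elim: k S u p q => [//|k IH] S u [[v i]|] [[v' i']|] //=.
by rewrite /dsum /= eq_sym; case: eqP => // ->; exact: IH.
Qed.

(** Vertex coordinates fill the diagonal and edge coordinates occur only off it, so the matrix at
    the point with vertex coordinates 1 and edge coordinates 0 is the identity. *)
Lemma tree_pattern_diag (R : nzRingType) k S u p q :
  oapp (fun c : coord => if c is inl _ then 1 else 0) 0 (@tree_pattern k S u p q)
  = (p == q)%:R :> R.
Proof.
elim: k S u p q => [|k IH] S u; first by case; case.
case=> [[v i]|] [[v' i']|] //=; first last.
- by case: ifP => // _; case: edge_of.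
- by case: ifP => // _; case: edge_of.
rewrite /dsum /= -[Some _ == Some _]/((v, i) == (v', i')) xpair_eqE.
by case: (v == v') => //=; exact: IH.
Qed.

Variable R : realFieldType.
Implicit Types (x : coord -> R) (S : {set V}).

Definition tree_form k S u x f : R := pform (@tree_pattern k S u) x f.

Definition vmu S x : R := mu S (x \o inl) (x \o inr).

Definition link S u x v : R :=
  if v \in S then oapp (x \o inr) 0 (edge_of E u v) else 0.

Lemma tree_form0 S u x f :
  tree_form (k := 0) S u x f = x (inl u) * f tt ^+ 2.
Proof.
rewrite expr2 mulrA /tree_form /pform.
by rewrite (big_pred1 (tt : tree_node 0)) ?(big_pred1 (tt : tree_node 0)) // => -[].
Qed.

Lemma tree_formS k S u x f :
  tree_form (k := k.+1) S u x f = x (inl u) * f None ^+ 2 +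
    \sum_v (2 * link S u x v * f None * f (Some (v, tree_root k))
      + tree_form (S :\ v) v x (fun i => f (Some (v, i)))).
Proof.
rewrite {1}/tree_form {1}/pform big_option big_option /= -addrA expr2 mulrA.
congr (_ + _).
have row : \sum_(p : V * tree_node k)
    oapp x 0 (let (v, i) := p in
       if (v \in S) && (i == tree_root k) then omap inr (edge_of E u v) else None)
      * f None * f (Some p)
  = \sum_v link S u x v * f None * f (Some (v, tree_root k)).
  rewrite sum_pair; apply: eq_bigr => v _; rewrite (bigD1 (tree_root k)) //= big1 ?addr0.
    by rewrite eqxx andbT /link; case: ifP => //; case: edge_of.
  by move=> i /negPf ->; rewrite andbF /= !mul0r.
have -> : \sum_p \sum_q oapp x 0
     (@tree_pattern k.+1 S u (Some p) q) * f (Some p) * f q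
   = \sum_(p : V * tree_node k)
    oapp x 0 (let (v, i) := p in
       if (v \in S) && (i == tree_root k) then omap inr (edge_of E u v) else None)
      * f None * f (Some p)
   + pform (dsum (fun v => @tree_pattern k (S :\ v) v)) x (fun p => f (Some p)).
  rewrite -big_split /=; apply: eq_bigr => -[v i] _.
  by rewrite big_option; congr (_ + _); rewrite mulrAC.
rewrite row pform_dsum addrA -!big_split /=; apply: eq_bigr => v _.
by rewrite /tree_form; ring.
Qed.

(** The recurrence in continued-fraction form: this is also how the Schur complement at the root of
    a tree is computed from those of its subtrees. *)
Lemma vmu_ratio S u x : u \notin S -> (forall v, v \in S -> 0 < vmu (S :\ v) x) ->
  0 < vmu S x ->
  vmu (u |: S) x / vmu S x =
    x (inl u) - \sum_(v in S) link S u x v ^+ 2 / (vmu S x / vmu (S :\ v) x).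
Proof.
move=> uS Sv S0; rewrite {1}/vmu mu_setU1 // mulrBl mulfK ?gt_eqF //.
congr (_ - _); rewrite mulr_suml; apply: eq_bigr => v vS.
by rewrite /link vS invf_div mulrA.
Qed.

Lemma complete_square (r c f g : R) : 0 < r ->
  - (c ^+ 2 / r * f ^+ 2) <= 2 * c * f * g + r * g ^+ 2.
Proof.
move=> r0; rewrite -subr_ge0.
have -> : 2 * c * f * g + r * g ^+ 2 - - (c ^+ 2 / r * f ^+ 2)
        = r * (g + c * f / r) ^+ 2 by field; rewrite gt_eqF.
by rewrite mulr_ge0 ?sqr_ge0 // ltW.
Qed.

(** Each child is bounded by induction and its square completed. Truncation at depth 0 only omits
    the nonnegative terms subtracted in [vmu_ratio], so the bound holds for every [k]. *)
Lemma tree_form_ge k S u x f : (forall S', 0 < vmu S' x) -> u \notin S ->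
  vmu (u |: S) x / vmu S x * f (tree_root k) ^+ 2 <= tree_form (k := k) S u x f.
Proof.
move=> x0; elim: k S u f => [|k IH] S u f uS; rewrite vmu_ratio //.
  rewrite tree_form0 ler_wpM2r ?sqr_ge0 // gerBl; apply: sumr_ge0 => v _.
  by rewrite divr_ge0 ?sqr_ge0 // ltW // divr_gt0.
rewrite tree_formS mulrBl lerD2l mulr_suml -sumrN big_mkcond /=.
apply: ler_sum => v _; have := IH (S :\ v) v (fun i => f (Some (v, i))).
rewrite setD11 => /(_ isT) /=; case: ifP => vS; last first.
  (* A detached child contributes only the form of its own subtree, nonnegative by induction. *)
  move=> h; rewrite /link vS !(mulr0, mul0r) add0r; apply: le_trans h.
  by rewrite mulr_ge0 ?sqr_ge0 // ltW // divr_gt0.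
rewrite setD1K // => h; apply: le_trans (lerD (lexx _) h).
by apply: complete_square; rewrite divr_gt0.
Qed.

(** At depth at least [#|S|] no self-avoiding walk is cut off, so all completed squares can vanish
    together. Positivity is assumed on subsets of [S] only, which permits use inside the induction
    of [vmu_gt0]. *)
Lemma tree_form_attained k S u x : (#|S| <= k)%N -> u \notin S ->
  (forall S', S' \subset S -> 0 < vmu S' x) ->
  exists f, f (tree_root k) = 1 /\
    tree_form (k := k) S u x f = vmu (u |: S) x / vmu S x.
Proof.
elim: k S u => [|k IH] S u Sk uS x0.
  have S0 : S = set0 by apply/eqP; rewrite -cards_eq0 -leqn0.
  exists (fun=> 1); split=> //; rewrite vmu_ratio ?x0 // => [|v]; last first.
    by rewrite S0 inE.
  by rewrite S0 big_set0 tree_form0 expr1n mulr1 subr0.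
have [v|F FP] := @fin_all_exists V _
    (fun v f => v \in S -> f (tree_root k) = 1 /\
       tree_form (k := k) (S :\ v) v x f = vmu S x / vmu (S :\ v) x).
  have [vS|_] := boolP (v \in S); last by exists (fun=> 0).
  have [||S' hS'|f] := IH (S :\ v) v; rewrite ?setD11 //.
  - by rewrite (cardsD1 v) vS in Sk.
  - by apply: x0; apply: subset_trans hS' (subsetDl _ _).
  by rewrite setD1K // => hf; exists f.
(* The value at the child [v] that makes the completed square vanish when the root has value 1;
   detached subtrees get 0. *)
pose c v : R := if v \in S then - (link S u x v / (vmu S x / vmu (S :\ v) x)) else 0.
exists (fun p => if p is Some (v, i) then c v * F v i else 1); split=> //.
have Sv v : v \in S -> 0 < vmu (S :\ v) x by move=> _; apply/x0/subsetDl.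
have S0 : 0 < vmu S x by exact: x0.
rewrite tree_formS vmu_ratio // expr1n mulr1; congr (_ + _).
rewrite -sumrN [RHS]big_mkcond; apply: eq_bigr => v _ /=.
rewrite /tree_form pformZ -/(tree_form _ _ _ _) /c; case: ifP => vS.
  have [-> ->] := FP v vS; field.
  by rewrite !gt_eqF // Sv.
by rewrite !mul0r expr0n mul0r mulr0 addr0.
Qed.

(** By induction on [S]: the form of the tree for [S :\ u] attains [vmu S x / vmu (S :\ u) x], whose
    denominator is already positive. *)
Lemma vmu_gt0 k x : (#|V| <= k)%N ->
  (forall S u f, u \notin S -> f (tree_root k) = 1 ->
    0 < tree_form (k := k) S u x f) ->
  forall S, 0 < vmu S x.
Proof.
move=> Vk x0; elim/proper_set_ind => S IH.
have [->|[u uS]] := set_0Vmem S; first by rewrite /vmu mu_set0.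
have SuS := properD1 uS.
have [||S' hS'|f [f1 ff]] := @tree_form_attained k (S :\ u) u x.
- exact: leq_trans (max_card _) Vk.
- by rewrite setD11.
- by apply: IH; exact: sub_proper_trans hS' SuS.
have : 0 < tree_form (k := k) (S :\ u) u x f by apply: x0; rewrite ?setD11.
by rewrite ff setD1K // pmulr_lgt0 // invr_gt0; exact: IH.
Qed.

End PathTree.

(** * The hyperbolicity cone as the positive semidefinite locus of a pencil *)

Section HyperbolicityCone.
Local Open Scope ring_scope.
Variables (R : realType) (V : finType) (E : {set {set V}}).
Hypothesis E_edges : forall e : {set V}, e \in E -> #|e| = 2%N.

Local Notation K := (V + edge E)%type.

Definition point (x : 'rV[R]_(nvars E)) (c : K) : R := x 0 (enum_rank c).

Definition unit_dir (c : K) : R := if c is inl _ then 1 else 0.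

Definition shift (x : K -> R) (s : R) (c : K) : R := x c + s * unit_dir c.

Lemma point_ones_zeros c : point (ones_zeros R E) c = unit_dir c.
Proof. by rewrite /point mxE enum_rankK. Qed.

Lemma matching_polyE :
  matching_poly R E = mu setT (@vertex_var R V E) (@edge_var R V E).
Proof.
apply: eq_big => [M|M _]; first by rewrite subsetT andbT.
by congr (_ * _ * _); apply: eq_bigl => v; rewrite !inE andbT.
Qed.

Lemma line_polyE (x : 'rV[R]_(nvars E)) :
  line_poly (matching_poly R E) (ones_zeros R E) x =
  mu setT (fun v => 'X - (point x (inl v))%:P)
          (fun e => (point x (inr e))%:P).
Proof.
rewrite /line_poly matching_polyE rmorph_mu; apply: eq_mu => [v|e] /=.
  by rewrite mmapX mmap1U -/(point _ _) point_ones_zeros scale1r.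
rewrite mmapX mmap1U -[ones_zeros _ _ _ _]/(point _ _) point_ones_zeros.
by rewrite scale0r sub0r sqrrN.
Qed.

Lemma horner_line_poly (x : 'rV[R]_(nvars E)) (z : R[i]) :
  (map_poly (real_complex R)
     (line_poly (matching_poly R E) (ones_zeros R E) x)).[z] =
  mu setT (fun v => z - (point x (inl v))%:C%C)
          (fun e => (point x (inr e))%:C%C).
Proof.
rewrite line_polyE rmorph_mu -[LHS]/(horner_eval z _) rmorph_mu.
apply: eq_mu => [v|e] /=; rewrite /horner_eval.
  by rewrite rmorphB /= map_polyX map_polyC !hornerE.
by rewrite map_polyC hornerC.
Qed.

Lemma mu_real_complex (S : {set V}) (a : V -> R) (w : edge E -> R) :
  mu S (fun v => (a v)%:C%C) (fun e => (w e)%:C%C) = (mu S a w)%:C%C.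
Proof. by rewrite -[RHS]/(real_complex R _) rmorph_mu. Qed.

Lemma vmu_shiftE S (x : K -> R) s :
  vmu S (shift x s) = mu_shift (x \o inl) (x \o inr) S s.
Proof.
by apply: eq_mu => [v|e]; rewrite /= /shift /unit_dir ?mulr1 ?mulr0 ?addr0.
Qed.

(** A zero [- s] of the line polynomial is a value [s] at which the full matching sum vanishes at
    the shifted point. [mu_shift_gt0] extends the absence of such [s > 0] to all induced subgraphs;
    conversely, real-rootedness reduces complex zeros to these real ones. *)
Lemma hyperbolicity_coneE (x : 'rV[R]_(nvars E)) :
  hyperbolicity_cone (matching_poly R E) (ones_zeros R E) x <->
  (forall S s, 0 < s -> 0 < vmu S (shift (point x) s)).
Proof.
(* At [z = - s] every vertex weight is the negative of the shifted coordinate, and [muN] extracts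
   the sign. *)
have muTE s : mu setT (fun v => (- s)%:C%C - (point x (inl v))%:C%C)
                (fun e => (point x (inr e))%:C%C) =
    ((-1) ^+ #|[set: V]| * vmu setT (shift (point x) s))%:C%C.
  rewrite vmu_shiftE -muN // -mu_real_complex.
  by apply: eq_mu => [v|e] //=; rewrite -rmorphB opprD addrC.
split=> [hx S s s0|pos z].
  rewrite vmu_shiftE; apply: mu_shift_gt0 s0 => // t t0.
  rewrite -vmu_shiftE; apply/eqP => m0.
  have := hx (- t)%:C%C; rewrite rootE horner_line_poly muTE m0 mulr0 eqxx.
  by move=> /(_ isT); rewrite lecR oppr_ge0 leNgt t0.
rewrite rootE horner_line_poly => /eqP hz.
have := mu_real_rooted E_edges hz; move: hz; case: z => a b hz /= b0.
rewrite b0 in hz *; rewrite lecE /= eqxx /= leNgt; apply/negP => a0.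
have := muTE (- a); rewrite opprK hz => -[/esym/eqP].
by rewrite mulf_eq0 signr_eq0 /= gt_eqF // pos // oppr_gt0.
Qed.

Definition walk_ix : finType :=
  (({set V} * V) * tree_node V #|V|)%type : finType.

(* One path tree for each induced subgraph and each of its vertices, so that the
   pencil controls all the matching polynomials of induced subgraphs. *)
Definition walk_pattern : pattern K walk_ix :=
  dsum (fun l : {set V} * V => @tree_pattern V E #|V| (l.1 :\ l.2) l.2).

Lemma walk_pattern_sym p q : walk_pattern p q = walk_pattern q p.
Proof.
by rewrite /walk_pattern /dsum eq_sym; case: eqP => // ->; exact: tree_pattern_sym.
Qed.

Lemma walk_pattern_diag p q :
  oapp unit_dir 0 (walk_pattern p q) = (p == q)%:R.
Proof.
case: p q => [l i] [l' i']; rewrite /walk_pattern /dsum /= xpair_eqE.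
by case: (l == l') => //; exact: tree_pattern_diag.
Qed.

Definition walk_form (x : K -> R) f := pform walk_pattern x f.

Lemma walk_form_unit_dir f : walk_form unit_dir f = \sum_p f p ^+ 2.
Proof.
apply: eq_bigr => p _; rewrite (bigD1 p) //= big1 ?addr0 => [|q qp].
  by rewrite walk_pattern_diag eqxx mul1r.
by rewrite walk_pattern_diag eq_sym (negPf qp) !mul0r.
Qed.

Lemma walk_form_shift x s f :
  walk_form (shift x s) f = walk_form x f + s * \sum_p f p ^+ 2.
Proof.
rewrite -walk_form_unit_dir mulr_sumr -big_split; apply: eq_bigr => p _ /=.
rewrite mulr_sumr -big_split; apply: eq_bigr => q _ /=.
by case: (walk_pattern p q) => [c|] /=; rewrite /shift; ring.
Qed.

(** A nonnegative form becomes positive definite after a shift by [s > 0], and [vmu_gt0] applies to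
    each block. Conversely, [tree_form_ge] makes each shifted form nonnegative, and [s] is taken
    small. *)
Lemma walk_form_ge0P x :
  (forall f, 0 <= walk_form x f) <->
  (forall S s, 0 < s -> 0 < vmu S (shift x s)).
Proof.
split=> [x0 S s s0|pos f].
  apply: (vmu_gt0 E_edges (leqnn _)) => {}S u f uS f1.
  (* Extension of [f] by zero from the block labelled [(u |: S, u)], whose tree walks in [S] because
     [u] is removed from the first component. *)
  pose g (p : walk_ix) := if p.1 == (u |: S, u) then f p.2 else 0.
  have -> : tree_form S u (shift x s) f = walk_form (shift x s) g.
    rewrite /walk_form pform_dsum (bigD1 (u |: S, u)) //= big1 ?addr0.
      by rewrite setU1K // /g /= eqxx.
    move=> l /negPf lS; apply: big1 => i _; apply: big1 => j _.
    by rewrite /g /= lS mulr0.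
  rewrite walk_form_shift ltr_wpDl // mulr_gt0 //.
  rewrite (bigD1 ((u |: S, u), tree_root V #|V|)) //= {1}/g /= eqxx f1 expr1n.
  by rewrite ltr_wpDr // sumr_ge0 // => p _; rewrite sqr_ge0.
have shift_ge0 s : 0 < s -> 0 <= walk_form (shift x s) f.
  move=> s0; rewrite /walk_form pform_dsum; apply: sumr_ge0 => -[S u] _ /=.
  apply: le_trans (tree_form_ge E_edges _ _ _); last by rewrite setD11.
    by rewrite mulr_ge0 ?sqr_ge0 // ltW // divr_gt0 // pos.
  by move=> S'; exact: pos.
rewrite leNgt; apply/negP => fx.
set N := \sum_p f p ^+ 2.
have N0 : 0 <= N by apply: sumr_ge0 => p _; exact: sqr_ge0.
(* For this [s] the shifted form equals [walk_form x f / (N + 1)], still negative; the 1 keeps the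
   denominator positive. *)
have := shift_ge0 (- walk_form x f / (N + 1)).
rewrite walk_form_shift -/N divr_gt0 ?oppr_gt0 ?ltr_wpDl // => /(_ isT).
have -> : walk_form x f + - walk_form x f / (N + 1) * N = walk_form x f / (N + 1).
  by field; rewrite gt_eqF // ltr_wpDl.
by rewrite leNgt pmulr_llt0 ?fx // invr_gt0 ltr_wpDl.
Qed.

Definition walk_mx (k : 'I_(nvars E)) : 'M[R]_#|walk_ix| :=
  \matrix_(i, j)
    (walk_pattern (enum_val i) (enum_val j) == Some (enum_val k))%:R.

Lemma walk_mx_sym k : (walk_mx k)^T = walk_mx k.
Proof. by apply/matrixP => i j; rewrite !mxE walk_pattern_sym. Qed.

Lemma walk_pencilE (x : 'rV[R]_(nvars E)) i j :
  (\sum_k x 0 k *: walk_mx k) i j =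
  oapp (point x) 0 (walk_pattern (enum_val i) (enum_val j)).
Proof.
rewrite summxE; case h : (walk_pattern _ _) => [c|] /=.
  rewrite (bigD1 (enum_rank c)) //= big1 ?addr0 => [|k kc].
    by rewrite !mxE h enum_rankK eqxx mulr1.
  rewrite !mxE h; case: eqP => [[ck]|_]; last by rewrite mulr0.
  by rewrite ck enum_valK eqxx in kc.
by rewrite big1 // => k _; rewrite !mxE h mulr0.
Qed.

Lemma walk_pencil_form (x : 'rV[R]_(nvars E)) (v : 'cV[R]_#|walk_ix|) :
  (v^T *m (\sum_k x 0 k *: walk_mx k) *m v) 0 0 =
  walk_form (point x) (fun p => v (enum_rank p) 0).
Proof.
rewrite -mulmxA mxE /walk_form /pform.
rewrite [RHS](reindex _ (onW_bij _ (@enum_val_bij walk_ix))) /=.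
apply: eq_bigr => i _; rewrite !mxE mulr_sumr.
rewrite [RHS](reindex _ (onW_bij _ (@enum_val_bij walk_ix))) /=.
by apply: eq_bigr => j _; rewrite walk_pencilE !enum_valK; ring.
Qed.

Lemma walk_pencil_sym (x : 'rV[R]_(nvars E)) :
  (\sum_k x 0 k *: walk_mx k)^T = \sum_k x 0 k *: walk_mx k.
Proof.
by apply/matrixP => i j; rewrite mxE !walk_pencilE walk_pattern_sym.
Qed.

Lemma walk_pencil_psd (x : 'rV[R]_(nvars E)) :
  psdmx (\sum_k x 0 k *: walk_mx k) <-> forall f, 0 <= walk_form (point x) f.
Proof.
split=> [[_ x0] f|x0].
  have := x0 (\col_i f (enum_val i)); rewrite walk_pencil_form.
  rewrite (_ : walk_form _ _ = walk_form (point x) f) //.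
  by apply: eq_pform => p; rewrite mxE enum_rankK.
by split=> [|v]; [exact: walk_pencil_sym|rewrite walk_pencil_form].
Qed.

Lemma walk_pencil_pd :
  pdmx (\sum_k ones_zeros R E 0 k *: walk_mx k).
Proof.
split=> [|v v0]; first exact: walk_pencil_sym.
rewrite walk_pencil_form.
have -> : walk_form (point (ones_zeros R E)) (fun p => v (enum_rank p) 0)
        = \sum_p v (enum_rank p) 0 ^+ 2.
  rewrite -walk_form_unit_dir; apply: eq_bigr => p _; apply: eq_bigr => q _.
  by case: walk_pattern => //= c; rewrite point_ones_zeros.
have /cV0Pn[i vi] := v0.
rewrite (bigD1 (enum_val i)) //= enum_valK ltr_pwDl //.
  by rewrite lt_neqAle eq_sym sqrf_eq0 vi sqr_ge0.
by apply: sumr_ge0 => p _; exact: sqr_ge0.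
Qed.

Lemma card_walk_ix : (0 < #|V|)%N -> (0 < #|walk_ix|)%N.
Proof.
case/card_gt0P => u _; apply/card_gt0P.
by exists ((set0, u), tree_root V #|V|).
Qed.

End HyperbolicityCone.

Theorem theorem2p12 (R : realType) (V : finType) (E : {set {set V}})
  (E_edges : forall e : {set V}, e \in E -> #|e| = 2)
  (V_nonempty : 0 < #|V|) :
  spectrahedral (hyperbolicity_cone (matching_poly R E) (ones_zeros R E)).
Proof.
exists #|walk_ix V|, (@walk_mx R V E); split.
- exact: card_walk_ix.
- exact: walk_mx_sym.
- by exists (ones_zeros R E); exact: walk_pencil_pd.
- move=> x; rewrite hyperbolicity_coneE // -walk_form_ge0P //.
  by rewrite walk_pencil_psd.
Qed.
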